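(* Let $\mathbf{OrdTop}_{\mathrm{OC}}^{\bullet}$ be the full subcategory of $\mathbf{OrdTop}$ on the ordered spaces that have open cones and enough points, and let $\mathbf{OrdLoc}^{\bullet}$ be the full subcategory of $\mathbf{OrdLoc}$ on the ordered locales satisfying (P). Then the assignments $(S,\le)\mapsto(\mathcal{O}S,\trianglelefteq)$, $g\mapsto\mathcal{O}g$ and $(X,\trianglelefteq)\mapsto(\mathrm{pt}(X),\le)$, $f\mapsto\mathrm{pt}(f)$ define functors $$\mathcal{O}\colon \mathbf{OrdTop}_{\mathrm{OC}}^{\bullet}\to\mathbf{OrdLoc}^{\bullet},\qquad \mathrm{pt}\colon\mathbf{OrdLoc}^{\bullet}\to\mathbf{OrdTop}_{\mathrm{OC}}^{\bullet},$$ and these form an adjunction $\mathcal{O}\dashv\mathrm{pt}$ (with $\mathcal{O}$ left adjoint), with unit $\eta$ and counit $\varepsilon$.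
   Context: Ordered spaces. A preorder is a reflexive transitive relation. An ordered space is a topological space $S$ with a preorder $\le$ on its underlying set (no compatibility assumed). $\mathbf{OrdTop}$ is the category of ordered spaces and continuous monotone functions. For $A\subseteq S$ put ${\uparrow}A=\{y\mid\exists x\in A: x\le y\}$ and ${\downarrow}A=\{x\mid\exists y\in A: x\le y\}$. $S$ has open cones if ${\uparrow}U$ and ${\downarrow}U$ are open for every open $U\subseteq S$. Ordered locales. A locale $X$ is given by its frame $\mathcal{O}X$ (order $\sqsubseteq$, joins $\bigvee$); a locale morphism $f\colon X\to Y$ is a frame morphism $f^{-1}\colon\mathcal{O}Y\to\mathcal{O}X$. An ordered locale is a locale $X$ with a preorder $\trianglelefteq$ on $\mathcal{O}X$ such that for every index set $I$, if $U_i\trianglelefteq V_i$ for all $i\in I$ then $\bigvee_i U_i\trianglelefteq\bigvee_i V_i$. A locale morphism $f\colon X\to Y$ between ordered locales is upper monotone if whenever $U\trianglelefteq U'$ in $\mathcal{O}X$ and $U\sqsubseteq f^{-1}V$ there is $V'\in\mathcal{O}Y$ with $V\trianglelefteq V'$ and $U'\sqsubseteq f^{-1}V'$; lower monotone if whenever $U\trianglelefteq U'$ and $U'\sqsubseteq f^{-1}V'$ there is $V\in\mathcal{O}Y$ with $V\trianglelefteq V'$ and $U\sqsubseteq f^{-1}V$; monotone if both. $\mathbf{OrdLoc}$ is the category of ordered locales and monotone locale morphisms. Opens. For an ordered space $S$, $\mathcal{O}S$ is the frame of open sets with the Egli-Milner preorder: $U\trianglelefteq V$ iff $U\subseteq{\downarrow}V$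 and $V\subseteq{\uparrow}U$. For continuous $g\colon S\to T$, $\mathcal{O}g$ is the locale morphism with frame map $V\mapsto g^{-1}(V)$. Points. A point of a locale $X$ is a completely prime filter $\mathcal{F}\subseteq\mathcal{O}X$; $\mathrm{pt}(X)$ is the set of points with open sets $\mathrm{pt}(U)=\{\mathcal{F}\mid U\in\mathcal{F}\}$, $U\in\mathcal{O}X$, and preorder $\mathcal{F}\le\mathcal{G}$ iff ($\forall U\in\mathcal{F}\,\exists V\in\mathcal{G}: U\trianglelefteq V$) and ($\forall V\in\mathcal{G}\,\exists U\in\mathcal{F}: U\trianglelefteq V$). For a locale morphism $f\colon X\to Y$, $\mathrm{pt}(f)(\mathcal{F})=\{V\in\mathcal{O}Y\mid f^{-1}(V)\in\mathcal{F}\}$. Unit and counit. $\eta_S\colon S\to\mathrm{pt}(\mathcal{O}S)$ is $x\mapsto\mathcal{F}_x=\{U\in\mathcal{O}S\mid x\in U\}$; $\varepsilon_X\colon\mathcal{O}(\mathrm{pt}(X))\to X$ is the locale morphism with frame map $U\mapsto\mathrm{pt}(U)$. Conditions. $S$ has enough points if $\eta_S$ is surjective. An ordered locale $X$ satisfies (P) if for all $U,V\in\mathcal{O}X$: $U\trianglelefteq V$ in $X$ implies $\mathrm{pt}(U)\trianglelefteq\mathrm{pt}(V)$ in $\mathcal{O}(\mathrm{pt}(X))$. *)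

(* Defs.v *)
From HB Require Import structures.
From mathcomp Require Import all_boot all_order all_classical topology.
From Corelib Require Import RelationClasses.

Set Implicit Arguments.
Unset Strict Implicit.
Unset Printing Implicit Defensive.

Import Order.TTheory.
Local Open Scope classical_set_scope.

(* Hom-sets are compared with Leibniz equality; since morphisms are functions
   carrying proofs, this is equality of the underlying functions. *)
Record category := Category {
  obj :> Type;
  hom : obj -> obj -> Type;
  idm : forall a, hom a a;
  comp : forall x y z, hom y z -> hom x y -> hom x z;
  compA : forall a b c d (h : hom c d) (g : hom b c) (f : hom a b),
    comp h (comp g f) = comp (comp h g) f;
  comp1m : forall a b (f : hom a b), comp (idm b) f = f;
  compm1 : forall a b (f : hom a b), comp f (idm a) = f }.

Arguments hom {_} _ _.
Arguments idm {_} _.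
Arguments comp {_ _ _ _} _ _.

Definition is_functor (C D : category) (F : C -> D)
    (Fm : forall a b : C, hom a b -> hom (F a) (F b)) : Prop :=
  (forall a : C, Fm a a (idm a) = idm (F a)) /\
  (forall (a b c : C) (g : hom b c) (f : hom a b),
     Fm a c (comp g f) = comp (Fm b c g) (Fm a b f)).

Record functor (C D : category) := Functor {
  fobj :> C -> D;
  fmap : forall a b : C, hom a b -> hom (fobj a) (fobj b);
  fmapP : is_functor fmap }.

Arguments fmap {C D} _ {a b} _.

Definition is_natural (C D : category) (F G : C -> D)
    (Fm : forall a b : C, hom a b -> hom (F a) (F b))
    (Gm : forall a b : C, hom a b -> hom (G a) (G b))
    (t : forall a : C, hom (F a) (G a)) : Prop :=
  forall (a b : C) (f : hom a b), comp (t b) (Fm a b f) = comp (Gm a b f) (t a).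

(* L is the left adjoint. *)
Record is_adjunction (C D : category) (L : functor C D) (R : functor D C)
    (eta : forall c : C, hom c (R (L c)))
    (eps : forall d : D, hom (L (R d)) d) : Prop := IsAdjunction {
  unit_natural : is_natural (F := fun c : C => c) (G := fun c : C => R (L c))
    (fun _ _ f => f) (fun _ _ f => fmap R (fmap L f)) eta;
  counit_natural : is_natural (F := fun d : D => L (R d)) (G := fun d : D => d)
    (fun _ _ f => fmap L (fmap R f)) (fun _ _ f => f) eps;
  triangle_left : forall c : C, comp (eps (L c)) (fmap L (eta c)) = idm (L c);
  triangle_right : forall d : D, comp (fmap R (eps d)) (eta (R d)) = idm (R d) }.

Definition full_subcategory (C : category) (P : C -> Prop) : category :=
  @Category {a : C | P a} (fun a b => hom (sval a) (sval b))
    (fun a => idm (sval a)) (fun a b c g f => comp g f)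
    (fun a b c d h g f => compA h g f)
    (fun a b f => comp1m f) (fun a b f => compm1 f).

Record orderedSpace := OrderedSpace {
  space :> topologicalType;
  sle : space -> space -> Prop;
  sle_preorder : PreOrder sle }.

Arguments sle {o} _ _.

Definition upset (S : orderedSpace) (A : set S) : set S :=
  [set y | exists2 x, A x & sle x y].

Definition downset (S : orderedSpace) (A : set S) : set S :=
  [set x | exists2 y, A y & sle x y].

Definition open_cones (S : orderedSpace) : Prop :=
  forall U : set S, open U -> open (upset U) /\ open (downset U).

Definition is_ordtop_hom (S T : orderedSpace) (g : S -> T) : Prop :=
  continuous g /\ (forall x y, sle x y -> sle (g x) (g y)).

Definition ordtop_hom (S T : orderedSpace) : Type :=
  {g : S -> T | is_ordtop_hom g}.

Lemma ordtop_id_subproof (S : orderedSpace) : is_ordtop_hom (@id S).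
Proof. by split=> // x; exact: cvg_id. Qed.

Lemma ordtop_comp_subproof (S T W : orderedSpace)
    (g : ordtop_hom T W) (f : ordtop_hom S T) :
  is_ordtop_hom (sval g \o sval f).
Proof.
case: g f => [g [gc gm]] [f [fc fm]]; split=> /= [x|x y xy].
  by apply: continuous_comp; [exact: fc|exact: gc].
exact/gm/fm.
Qed.

Definition ordtop_id (S : orderedSpace) : ordtop_hom S S :=
  exist _ _ (ordtop_id_subproof S).

Definition ordtop_comp (S T W : orderedSpace)
    (g : ordtop_hom T W) (f : ordtop_hom S T) : ordtop_hom S W :=
  exist _ _ (ordtop_comp_subproof g f).

Lemma sval_inj (T : Type) (P : T -> Prop) (u v : {x | P x}) :
  sval u = sval v -> u = v.
Proof. by case: u v => [x xP] [y yP] /= xy; exact: eq_exist. Qed.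

Program Definition OrdTop : category :=
  @Category orderedSpace ordtop_hom ordtop_id ordtop_comp _ _ _.
Next Obligation. by move=> *; exact: sval_inj. Qed.
Next Obligation. by move=> *; exact: sval_inj. Qed.
Next Obligation. by move=> *; exact: sval_inj. Qed.

HB.mixin Record TBLattice_isFrame d T of Order.TBLattice d T := {
  fsup : set T -> T;
  fsupP : forall A : set T, supremums A (fsup A);
  meet_fsup : forall (x : T) (A : set T),
    Order.meet x (fsup A) = fsup (Order.meet x @` A) }.

#[short(type="frameType")]
HB.structure Definition Frame d := {T of Order.TBLattice d T & TBLattice_isFrame d T}.

(* tri is the order written with a triangle, as opposed to the frame order <=%O;
   the join of a family U : I -> frame is fsup (range U). *)
Record orderedLocale := OrderedLocale {
  locale_display : Order.disp_t;
  frame :> frameType locale_display;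
  tri : frame -> frame -> Prop;
  tri_preorder : PreOrder tri;
  tri_fsup : forall (I : Type) (U V : I -> frame),
    (forall i, tri (U i) (V i)) -> tri (fsup (range U)) (fsup (range V)) }.

Arguments tri {o} _ _.

Record is_frame_morphism d d' (X : frameType d) (Y : frameType d') (h : X -> Y) :
    Prop := IsFrameMorphism {
  fmorph_top : h Order.top = Order.top;
  fmorph_meet : forall U V, h (Order.meet U V) = Order.meet (h U) (h V);
  fmorph_fsup : forall A : set X, h (fsup A) = fsup (h @` A) }.

(* A locale morphism X -> Y is a frame morphism in the opposite direction. *)
Record localeHom d d' (X : frameType d) (Y : frameType d') := LocaleHom {
  frame_map : Y -> X;
  frame_mapP : is_frame_morphism frame_map }.

Lemma localeHom_eq d d' (X : frameType d) (Y : frameType d') (f g : localeHom X Y) :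
  frame_map f = frame_map g -> f = g.
Proof.
case: f g => [f fP] [g gP] /= fg; rewrite fg in fP *.
by congr LocaleHom; exact: Prop_irrelevance.
Qed.

Lemma locale_id_subproof d (X : frameType d) : is_frame_morphism (@id X).
Proof. by split=> // A; rewrite image_id. Qed.

Lemma locale_comp_subproof d d' d'' (X : frameType d) (Y : frameType d')
    (Z : frameType d'') (g : localeHom Y Z) (f : localeHom X Y) :
  is_frame_morphism (frame_map f \o frame_map g).
Proof.
case: g f => [g [gT gI gS]] [f [fT fI fS]]; split=> /= [|U V|A].
- by rewrite gT fT.
- by rewrite gI fI.
- by rewrite gS fS image_comp.
Qed.

Definition locale_id d (X : frameType d) : localeHom X X :=
  LocaleHom (locale_id_subproof X).

Definition locale_comp d d' d'' (X : frameType d) (Y : frameType d')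
    (Z : frameType d'') (g : localeHom Y Z) (f : localeHom X Y) : localeHom X Z :=
  LocaleHom (locale_comp_subproof g f).

Definition upper_monotone (X Y : orderedLocale) (f : localeHom X Y) : Prop :=
  forall (U U' : X) (V : Y), tri U U' -> (U <= frame_map f V)%O ->
    exists V' : Y, tri V V' /\ (U' <= frame_map f V')%O.

Definition lower_monotone (X Y : orderedLocale) (f : localeHom X Y) : Prop :=
  forall (U U' : X) (V' : Y), tri U U' -> (U' <= frame_map f V')%O ->
    exists V : Y, tri V V' /\ (U <= frame_map f V)%O.

Definition monotone (X Y : orderedLocale) (f : localeHom X Y) : Prop :=
  upper_monotone f /\ lower_monotone f.

Definition ordloc_hom (X Y : orderedLocale) : Type :=
  {f : localeHom X Y | monotone f}.

Lemma fsup_ub d (X : frameType d) (A : set X) U : A U -> (U <= fsup A)%O.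
Proof. by have [ub _] := fsupP A; exact: ub. Qed.

Lemma fsup_le d (X : frameType d) (A : set X) V :
  (forall U, A U -> (U <= V)%O) -> (fsup A <= V)%O.
Proof. by have [_ lub] := fsupP A; exact: lub. Qed.

Lemma fsup_unique d (X : frameType d) (A : set X) V : supremums A V -> fsup A = V.
Proof. by move=> AV; apply: (is_subset1_supremums _ AV); exact: fsupP. Qed.

Lemma joinEfsup d (X : frameType d) (U V : X) :
  Order.join U V = fsup (range (fun b : bool => if b then U else V)).
Proof.
apply/esym/fsup_unique; split.
  by move=> _ [[] _ <-]; rewrite ?leUl ?leUr.
by move=> W ub; rewrite leUx; apply/andP; split; apply: ub;
  [exists true|exists false].
Qed.

Lemma tri_join (X : orderedLocale) (U V U' V' : X) :
  tri U V -> tri U' V' -> tri (Order.join U U') (Order.join V V').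
Proof. by move=> UV UV'; rewrite !joinEfsup; apply: tri_fsup => -[]. Qed.

Lemma ordloc_id_subproof (X : orderedLocale) : monotone (locale_id X).
Proof.
have [rfl _] := tri_preorder X.
split=> [U U' V UU' /= UV|U U' V UU' /= UV].
  exists (Order.join U' V); split; last exact: leUl.
  by rewrite -(join_idPr UV); apply: tri_join => //; rewrite (join_idPr UV).
exists (Order.join U V); split; last exact: leUl.
by rewrite -{2}(join_idPr UV); apply: tri_join.
Qed.

Lemma ordloc_comp_subproof (X Y Z : orderedLocale)
    (g : ordloc_hom Y Z) (f : ordloc_hom X Y) :
  monotone (locale_comp (sval g) (sval f)).
Proof.
case: g f => [g [gu gl]] [f [fu fl]]; have [_ fI _] := frame_mapP f.
have fle (A B : Y) : (A <= B)%O -> (frame_map f A <= frame_map f B)%O.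
  by rewrite !leEmeet -fI => /eqP ->.
split=> /= U U' W UU' UW.
  have [V [tV lV]] := fu _ _ _ UU' UW.
  have [W' [tW lW]] := gu _ _ _ tV (lexx _).
  by exists W'; split=> //; apply: le_trans lV (fle _ _ lW).
have [V [tV lV]] := fl _ _ _ UU' UW.
have [W' [tW lW]] := gl _ _ _ tV (lexx _).
by exists W'; split=> //; apply: le_trans lV (fle _ _ lW).
Qed.

Definition ordloc_id (X : orderedLocale) : ordloc_hom X X :=
  exist _ _ (ordloc_id_subproof X).

Definition ordloc_comp (X Y Z : orderedLocale)
    (g : ordloc_hom Y Z) (f : ordloc_hom X Y) : ordloc_hom X Z :=
  exist _ _ (ordloc_comp_subproof g f).

Program Definition OrdLoc : category :=
  @Category orderedLocale ordloc_hom ordloc_id ordloc_comp _ _ _.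
Next Obligation. by move=> *; apply/sval_inj/localeHom_eq. Qed.
Next Obligation. by move=> *; apply/sval_inj/localeHom_eq. Qed.
Next Obligation. by move=> *; apply/sval_inj/localeHom_eq. Qed.

(* Openness is reflected into bool so that opens S is a subType of the lattice
   set S, from which it inherits inclusion, intersection and union. *)
Record opens (S : topologicalType) := Opens {
  open_set :> set S;
  open_setPb : `[< open open_set >] }.

HB.instance Definition _ (S : topologicalType) := [isSub for @open_set S].
HB.instance Definition _ (S : topologicalType) := [Choice of opens S by <:].

Section opens_frame.
Context (S : topologicalType).

Lemma open_setP (U : opens S) : open (U : set S).
Proof. exact/asboolP/open_setPb. Qed.

Definition mk_open (A : set S) (Ao : open A) : opens S :=
  Opens (introT (asboolP _) Ao).

Let openb := [pred A : set S | `[< open A >]].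

Let openb_meet : meet_closed openb.
Proof. by move=> A B /asboolP Ao /asboolP Bo; exact/asboolP/openI. Qed.

Let openb_join : join_closed openb.
Proof. by move=> A B /asboolP Ao /asboolP Bo; exact/asboolP/openU. Qed.

Let openb_bot : \bot%O \in openb. Proof. exact/asboolP/open0. Qed.

Let openb_top : \top%O \in openb. Proof. exact/asboolP/openT. Qed.

HB.instance Definition _ :=
  Order.SubChoice_isTBSubLattice.Build set_display (set S) (fun A => `[< open A >])
    set_display (opens S) openb_meet openb_join openb_bot openb_top.

End opens_frame.

Lemma opens_leE (S : topologicalType) (U V : opens S) :
  (U <= V)%O = ((U : set S) `<=` V) :> Prop.
Proof. by rewrite -subsetEset. Qed.

Lemma opens_meetE (S : topologicalType) (U V : opens S) :
  Order.meet U V = (U : set S) `&` V :> set S.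
Proof. by []. Qed.

Section opens_isFrame.
Context (S : topologicalType).

Lemma bigcup_opens_subproof (A : set (opens S)) :
  open (\bigcup_(U in A) (U : set S)).
Proof. by apply: bigcup_open => U _; exact: open_setP. Qed.

Definition opens_sup (A : set (opens S)) : opens S :=
  mk_open (bigcup_opens_subproof A).

Let opens_supP (A : set (opens S)) : supremums A (opens_sup A).
Proof.
split=> [U AU|V ub]; rewrite opens_leE => x; first by move=> Ux; exists U.
by move=> [U AU Ux]; have := ub U AU; rewrite opens_leE; exact.
Qed.

Let opens_meet_sup (U : opens S) (A : set (opens S)) :
  Order.meet U (opens_sup A) = opens_sup (Order.meet U @` A).
Proof.
apply: val_inj; apply/seteqP; split=> x /=.
  move=> [Ux [V AV Vx]]; exists (Order.meet U V); first by exists V.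
  by rewrite opens_meetE.
move=> [_ [V AV <-]]; rewrite opens_meetE => -[Ux Vx]; split=> //.
by exists V.
Qed.

HB.instance Definition _ :=
  TBLattice_isFrame.Build set_display (opens S) opens_supP opens_meet_sup.

End opens_isFrame.

Definition egli_milner (S : orderedSpace) (U V : opens S) : Prop :=
  (U : set S) `<=` downset V /\ (V : set S) `<=` upset U.

Lemma egli_milner_preorder (S : orderedSpace) : PreOrder (@egli_milner S).
Proof.
have [rfl trans] := sle_preorder S.
split=> [U|U V W [UV VU] [VW WV]].
  by split=> x Ux; exists x => //; exact: rfl.
split=> x.
  move=> /UV[y /VW[z Wz yz] xy]; exists z => //; exact: trans xy yz.
move=> /WV[y /VU[z Uz yz] xy]; exists z => //; exact: trans yz xy.
Qed.

Lemma egli_milner_fsup (S : orderedSpace) (I : Type) (U V : I -> opens S) :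
  (forall i, egli_milner (U i) (V i)) ->
  egli_milner (fsup (range U)) (fsup (range V)).
Proof.
move=> UV; split=> x [_ [i _ <-]].
  move=> /(UV i).1[y Vy xy]; exists y => //.
  by exists (V i) => //; exists i.
move=> /(UV i).2[y Uy xy]; exists y => //.
by exists (U i) => //; exists i.
Qed.

Definition Opens_locale (S : orderedSpace) : orderedLocale :=
  OrderedLocale (egli_milner_preorder S) (@egli_milner_fsup S).

Section opens_map.
Context (S T : orderedSpace) (g : ordtop_hom S T).

Lemma preimage_open_subproof (V : opens T) : open (sval g @^-1` (V : set T)).
Proof.
by apply: open_comp (open_setP V) => x _; have [gc _] := svalP g; exact: gc.
Qed.

Definition opens_preimage (V : opens T) : opens S :=
  mk_open (preimage_open_subproof V).

Lemma opens_preimage_frame_morphism : is_frame_morphism opens_preimage.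
Proof.
split=> [|U V|A]; apply: val_inj => //=.
apply/seteqP; split=> x /=.
  by move=> [V AV Vx]; exists (opens_preimage V) => //; exists V.
by move=> [_ [V AV <-] Vx]; exists V.
Qed.

Definition Opens_map : localeHom (Opens_locale S) (Opens_locale T) :=
  LocaleHom opens_preimage_frame_morphism.

End opens_map.

Record is_completely_prime_filter d (X : frameType d) (F : set X) : Prop :=
    IsCompletelyPrimeFilter {
  cpf_top : F Order.top;
  cpf_meet : forall U V, F U -> F V -> F (Order.meet U V);
  cpf_up : forall U V, (U <= V)%O -> F U -> F V;
  cpf_prime : forall A : set X, F (fsup A) -> exists2 U, A U & F U }.

Record point d (X : frameType d) := Point {
  point_filter :> set X;
  point_filterP : is_completely_prime_filter point_filter }.

HB.instance Definition _ d (X : frameType d) := gen_eqMixin (point X).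
HB.instance Definition _ d (X : frameType d) := gen_choiceMixin (point X).

Lemma point_eq d (X : frameType d) (F G : point X) :
  F = G :> set X -> F = G.
Proof.
case: F G => [F FP] [G GP] /= FG; rewrite FG in FP *.
by congr Point; exact: Prop_irrelevance.
Qed.

Section point_topology.
Context d (X : frameType d).

Definition pt_set (U : X) : set (point X) := [set F | (F : set X) U].

Lemma pt_setT : pt_set Order.top = setT.
Proof. by apply/seteqP; split=> // F _; exact: cpf_top (point_filterP F). Qed.

Lemma pt_setI (U V : X) : pt_set (Order.meet U V) = pt_set U `&` pt_set V.
Proof.
apply/seteqP; split=> F /=; have [_ FI Fup _] := point_filterP F.
  by move=> FUV; split; [exact: Fup (leIl _ _) FUV|exact: Fup (leIr _ _) FUV].
by move=> [FU FV]; exact: FI.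
Qed.

Lemma pt_set_fsup (A : set X) : pt_set (fsup A) = \bigcup_(U in A) pt_set U.
Proof.
apply/seteqP; split=> F /=; have [_ _ Fup Fp] := point_filterP F.
  by move=> /Fp[U AU FU]; exists U.
by move=> [U AU FU]; exact: Fup (fsup_ub AU) FU.
Qed.

Let pt_op : set_system (point X) := range pt_set.

Let pt_opT : pt_op setT. Proof. by exists Order.top; rewrite ?pt_setT. Qed.

Let pt_opI : setI_closed pt_op.
Proof. by move=> _ _ [U _ <-] [V _ <-]; exists (Order.meet U V); rewrite ?pt_setI. Qed.

Let pt_op_bigcup (I : Type) (f : I -> set (point X)) :
  (forall i, pt_op (f i)) -> pt_op (\bigcup_i f i).
Proof.
move=> fop; exists (fsup [set U | exists i, pt_set U = f i]) => //.
rewrite pt_set_fsup; apply/seteqP; split=> F.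
  by move=> [U [i Ui] FU]; exists i => //; rewrite -Ui.
move=> [i _]; have [U _ Ui] := fop i; rewrite -Ui => FU.
by exists U => //; exists i.
Qed.

HB.instance Definition _ :=
  isOpenTopological.Build (point X) pt_opT pt_opI pt_op_bigcup.

Lemma open_pt_set (U : X) : open (pt_set U).
Proof. by exists U. Qed.

Definition pt_open (U : X) : opens (point X) := mk_open (open_pt_set U).

End point_topology.

Definition pt_le (X : orderedLocale) (F G : point X) : Prop :=
  (forall U, (F : set X) U -> exists2 V, (G : set X) V & tri U V) /\
  (forall V, (G : set X) V -> exists2 U, (F : set X) U & tri U V).

Lemma pt_le_preorder (X : orderedLocale) : PreOrder (@pt_le X).
Proof.
have [rfl trans] := tri_preorder X.
split=> [F|F G H [FG GF] [GH HG]].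
  by split=> U FU; exists U => //; exact: rfl.
split=> U.
  by move=> /FG[V /GH[W HW VW] UV]; exists W => //; exact: trans UV VW.
by move=> /HG[V /GF[W FW WV] VU]; exists W => //; exact: trans WV VU.
Qed.

Definition pt_space (X : orderedLocale) : orderedSpace :=
  OrderedSpace (pt_le_preorder X).

Section pt_map.
Context d d' (X : frameType d) (Y : frameType d') (f : localeHom X Y).

Lemma pt_map_subproof (F : point X) :
  is_completely_prime_filter (frame_map f @^-1` (F : set X)).
Proof.
have [fT fI fS] := frame_mapP f; have [FT FI Fup Fp] := point_filterP F.
split=> /= [|U V|U V UV|A].
- by rewrite fT.
- by rewrite fI; exact: FI.
- by apply: Fup; move: UV; rewrite !leEmeet -fI => /eqP ->.
- by rewrite fS => /Fp[_ [U AU <-] FU]; exists U.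
Qed.

Definition pt_map (F : point X) : point Y := Point (pt_map_subproof F).

End pt_map.

Lemma unit_subproof (S : topologicalType) (x : S) :
  is_completely_prime_filter [set U : opens S | (U : set S) x].
Proof.
split=> /= [//|U V Ux Vx|U V|A [U AU Ux]]; last by exists U.
  by split.
by rewrite opens_leE; exact.
Qed.

Definition unit_map (S : orderedSpace) (x : S) : pt_space (Opens_locale S) :=
  Point (unit_subproof x).

Lemma counit_subproof d (X : frameType d) : is_frame_morphism (@pt_open d X).
Proof.
split=> [|U V|A]; apply: val_inj => /=.
- exact: pt_setT.
- exact: pt_setI.
- by rewrite pt_set_fsup bigcup_image.
Qed.

Definition counit_map (X : orderedLocale) :
    localeHom (Opens_locale (pt_space X)) X :=
  LocaleHom (@counit_subproof _ X).

Definition enough_points (S : orderedSpace) : Prop :=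
  forall F : pt_space (Opens_locale S), exists x : S, unit_map x = F.

Definition satisfies_P (X : orderedLocale) : Prop :=
  forall U V : X, tri U V ->
    tri (pt_open U : Opens_locale (pt_space X)) (pt_open V).

Definition OrdTopOC : category :=
  full_subcategory (C := OrdTop) (fun S => open_cones S /\ enough_points S).

Definition OrdLocP : category := full_subcategory (C := OrdLoc) satisfies_P.

(* Main.v *)
Require Import Defs.
From mathcomp Require Import all_boot all_order all_classical topology.

Set Implicit Arguments.
Unset Strict Implicit.
Unset Printing Implicit Defensive.

Import Order.TTheory.
Local Open Scope classical_set_scope.

(** Open cones serve to choose witnesses. In a space with open cones every open
    [U] satisfies [U ⊴ ↑U] and [↓U ⊴ U], where both cones are again opens. A
    monotone map [g] sends [↑U] into [↑V] whenever it sends [U] into [V], so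
    [↑V] and [↓V] are the opens required for [O g] to be monotone
    ([Opens_map_monotone]). The same cones show that [x <= y] implies
    [F_x <= F_y] for the neighbourhood filters ([unit_map_le]), so the unit is a
    morphism. If moreover every point of [O S] is some [F_x], an Egli-Milner
    relation between opens of [S] transfers along the unit to the corresponding
    opens of points, which is condition (P) ([Opens_satisfies_P]).

    On the localic side, condition (P) makes the cones of [pt U] open: if
    [F <= G] and [U] belongs to [F], then [U ⊴ V] for some [V] in [G], and (P)
    places the whole neighbourhood [pt V] of [G] inside the up-closure of [pt U]
    ([pt_open_cones]). The order on points is chosen so that monotone locale
    morphisms induce monotone maps. The counit is monotone because a given [V]
    has a largest [V'] with [V ⊴ V'], the join of all of them; if a set of
    points contained in [pt V] is Egli-Milner below [W'], each point of [W']
    contains some [V'] with [V ⊴ V'], so [W'] lies in [pt] of that join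
    ([counit_map_monotone]).

    What remains, that is functoriality, naturality and the triangle identities,
    compares maps whose underlying functions agree because the points [F_x] and
    the opens [pt U] are defined by [U ∈ F_x iff x ∈ U] and
    [F ∈ pt U iff U ∈ F]. *)

(** * From ordered spaces to ordered locales *)

Section OpenCones.
Context (S : orderedSpace) (oc : open_cones S).

Definition up_open (U : opens S) : opens S := mk_open (oc (open_setP U)).1.

Definition down_open (U : opens S) : opens S := mk_open (oc (open_setP U)).2.

Lemma sub_up_open (U : opens S) : (U : set S) `<=` up_open U.
Proof. by have [rfl _] := sle_preorder S; move=> x Ux; exists x => //; exact: rfl. Qed.

Lemma sub_down_open (U : opens S) : (U : set S) `<=` down_open U.
Proof. by have [rfl _] := sle_preorder S; move=> x Ux; exists x => //; exact: rfl. Qed.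

Lemma egli_milner_up (U : opens S) : egli_milner U (up_open U).
Proof.
have [rfl _] := sle_preorder S; split=> // x Ux.
by exists x; [exact: sub_up_open | exact: rfl].
Qed.

Lemma egli_milner_down (U : opens S) : egli_milner (down_open U) U.
Proof.
have [rfl _] := sle_preorder S; split=> // x Ux.
by exists x; [exact: sub_down_open | exact: rfl].
Qed.

(** For [x <= y], the cone [↑U] of a neighbourhood [U] of [x] is a
    neighbourhood of [y] with [U ⊴ ↑U], and dually for [↓V]. *)
Lemma unit_map_le (x y : S) : sle x y -> pt_le (unit_map x) (unit_map y).
Proof.
move=> xy; split=> [U Ux | V Vy].
  by exists (up_open U); [exists x | exact: egli_milner_up].
by exists (down_open V); [exists y | exact: egli_milner_down].
Qed.

Lemma unit_map_mor : is_ordtop_hom (@unit_map S).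
Proof.
split; last exact: unit_map_le.
apply/continuousP => _ [U _ <-].
exact: (open_setP (S := S) U).
Qed.

(** Every point is some [unit_map x], so points above a given point can be
    found by going up in [S] itself. *)
Lemma Opens_satisfies_P : enough_points S -> satisfies_P (Opens_locale S).
Proof.
move=> ep U V [UV VU]; split=> F /=.
  have [x <-] := ep F => /UV[y Vy xy].
  by exists (unit_map y) => //; exact: unit_map_le.
have [y <-] := ep F => /VU[x Ux xy].
by exists (unit_map x) => //; exact: unit_map_le.
Qed.

End OpenCones.

(** The witnesses are the cones [↑V] and [↓V] of the given open [V] of [T]:
    being monotone, [g] maps the up-closure of [U] into [↑V] as soon as it maps
    [U] into [V], and likewise for [↓V]. *)
Lemma Opens_map_monotone (S T : orderedSpace) (g : ordtop_hom S T) :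
  open_cones T -> monotone (Opens_map g).
Proof.
move=> oc; have [_ gm] := svalP g.
split=> [U U' V [_ U'U] | U U' V [UU' _]]; rewrite opens_leE => subV.
  exists (up_open oc V); split; first exact: egli_milner_up.
  rewrite opens_leE => y /U'U[x /subV Vx xy].
  by exists (sval g x) => //; exact: gm.
exists (down_open oc V); split; first exact: egli_milner_down.
rewrite opens_leE => x /UU'[y /subV Vy xy].
by exists (sval g y) => //; exact: gm.
Qed.

(** * From ordered locales to ordered spaces *)

(** If [F <= G] with [F] in [pt U], some [V] in [G] has [U ⊴ V]; by (P) the
    neighbourhood [pt V] of [G] consists of points above [pt U]. *)
Lemma pt_open_cones (X : orderedLocale) :
  satisfies_P X -> open_cones (pt_space X).
Proof.
move=> XP _ [U _ <-]; split; rewrite openE => G [F FU FG].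
  have [V GV UV] := FG.1 U FU.
  apply: (@filterS _ _ _ (pt_set V)); first exact: (XP U V UV).2.
  exact: open_nbhs_nbhs (conj (open_pt_set V) GV).
have [V GV VU] := FG.2 U FU.
apply: (@filterS _ _ _ (pt_set V)); first exact: (XP V U VU).1.
exact: open_nbhs_nbhs (conj (open_pt_set V) GV).
Qed.

(** Pushing a point of [O (pt X)] forward along the counit gives a point of [X]
    whose neighbourhood filter is the original one, since every open of [pt X]
    has the form [pt U]. *)
Lemma pt_enough_points (X : orderedLocale) : enough_points (pt_space X).
Proof.
move=> P; exists (pt_map (counit_map X) P).
apply/point_eq/seteqP; split=> W; have [U _ UW] := open_setP W;
  by have -> : W = pt_open U by apply: val_inj.
Qed.

(** For [F <= G] and [f^-1 V] in [F] there is [U'] in [G] with [f^-1 V ⊴ U'];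
    upper monotonicity applied to [f^-1 V] itself then gives [V ⊴ V'] with
    [f^-1 V'] in [G]. Lower monotonicity gives the other half. *)
Lemma pt_map_mor (X Y : orderedLocale) (f : localeHom X Y) : monotone f ->
  @is_ordtop_hom (pt_space X) (pt_space Y) (pt_map f).
Proof.
move=> [fu fl]; split=> [|F G [FG GF]].
  by apply/continuousP => _ [V _ <-]; exact: (open_pt_set (frame_map f V)).
have [_ _ Fup _] := point_filterP F; have [_ _ Gup _] := point_filterP G.
split=> V /= fV.
  have [U' GU' tU'] := FG _ fV; have [V' [tV leV']] := fu _ _ _ tU' (lexx _).
  by exists V' => //; exact: Gup leV' GU'.
have [U FU tU] := GF _ fV; have [V' [tV leV']] := fl _ _ _ tU (lexx _).
by exists V' => //; exact: Fup leV' FU.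
Qed.

(** * The counit is monotone *)

Lemma fsup_const d (X : frameType d) (I : Type) (i : I) (V : X) :
  fsup (range (fun _ : I => V)) = V.
Proof. by apply: fsup_unique; split=> [_ [_ _ <-] // | W]; apply; exists i. Qed.

Lemma range_sval (T : Type) (A : T -> Prop) :
  range (fun u : {x | A x} => sval u) = [set x | A x].
Proof. by apply/seteqP; split=> [_ [[x ?] _ <-] | x Ax] //; exists (exist _ x Ax). Qed.

Section LargestRelated.
Context (X : orderedLocale) (V : X).

Definition tri_above : X := fsup [set V' | tri V V'].

Definition tri_below : X := fsup [set V' | tri V' V].

(** Compatibility with joins applies to [V] written as the join of a constant
    family, indexed by the opens [V'] with [V ⊴ V']. That join is [V], and not
    the bottom element, because reflexivity makes the index set inhabited. *)
Lemma tri_aboveP : tri V tri_above.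
Proof.
have [rfl _] := tri_preorder X.
have VV : {V' | tri V V'} by exists V; exact: rfl.
have := tri_fsup (fun u : {V' | tri V V'} => svalP u).
by rewrite (fsup_const VV) range_sval.
Qed.

Lemma tri_belowP : tri tri_below V.
Proof.
have [rfl _] := tri_preorder X.
have VV : {V' | tri V' V} by exists V; exact: rfl.
have := tri_fsup (fun u : {V' | tri V' V} => svalP u).
by rewrite (fsup_const VV) range_sval.
Qed.

End LargestRelated.

(** A point above some point of [pt V] contains a [V'] with [V ⊴ V'], hence
    contains the join of all such [V']; dually for points below. *)
Lemma counit_map_monotone (X : orderedLocale) : monotone (counit_map X).
Proof.
split=> [W W' V [_ W'W] | W W' V [WW' _]]; rewrite opens_leE => subV.
  exists (tri_above V); split; first exact: tri_aboveP.
  rewrite opens_leE => G /W'W[F /subV FV [FG _]].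
  have [V' GV' tV'] := FG V FV.
  have [_ _ Gup _] := point_filterP G.
  have leV' : (V' <= tri_above V)%O by exact: fsup_ub.
  exact: Gup leV' GV'.
exists (tri_below V); split; first exact: tri_belowP.
rewrite opens_leE => F /WW'[G /subV GV [_ GF]].
have [V' FV' tV'] := GF V GV.
have [_ _ Fup _] := point_filterP F.
have leV' : (V' <= tri_below V)%O by exact: fsup_ub.
exact: Fup leV' FV'.
Qed.

(** * The adjunction *)

Lemma opens_hom_eq (S : orderedSpace) (X : orderedLocale)
    (h k : ordloc_hom (Opens_locale S) X) :
  (forall V, frame_map (sval h) V = frame_map (sval k) V :> set S) -> h = k.
Proof.
move=> hk; apply/sval_inj/localeHom_eq/funext => V.
by apply: (val_inj (sT := opens S)); exact: hk.
Qed.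

Lemma pt_hom_eq (S : orderedSpace) (X : orderedLocale)
    (h k : ordtop_hom S (pt_space X)) :
  (forall x, sval h x = sval k x :> set X) -> h = k.
Proof. by move=> hk; apply/sval_inj/funext => x; exact/point_eq/hk. Qed.

Theorem theorem6p3 :
  (* O and pt are well defined on objects and on morphisms *)
  exists (O_obj : forall S : OrdTopOC, satisfies_P (Opens_locale (sval S)))
         (O_mor : forall (S T : OrdTopOC) (g : hom S T), monotone (Opens_map g))
         (pt_obj : forall X : OrdLocP,
            open_cones (pt_space (sval X)) /\ enough_points (pt_space (sval X)))
         (pt_mor : forall (X Y : OrdLocP) (f : hom X Y),
            @is_ordtop_hom (pt_space (sval X)) (pt_space (sval Y))
              (pt_map (sval f))),
  (* O and pt are functors *)
  exists (O_functor : @is_functor OrdTopOC OrdLocP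
            (fun S => exist _ (Opens_locale (sval S)) (O_obj S))
            (fun S T g => exist _ (Opens_map g) (O_mor S T g)))
         (pt_functor : @is_functor OrdLocP OrdTopOC
            (fun X => exist _ (pt_space (sval X)) (pt_obj X))
            (fun X Y f => exist _ (pt_map (sval f)) (pt_mor X Y f))),
  (* eta and epsilon consist of morphisms of the two categories *)
  exists (eta_mor : forall S : OrdTopOC, is_ordtop_hom (@unit_map (sval S)))
         (eps_mor : forall X : OrdLocP, monotone (counit_map (sval X))),
  (* O is left adjoint to pt with unit eta and counit epsilon *)
  @is_adjunction OrdTopOC OrdLocP (Functor O_functor) (Functor pt_functor)
    (fun S => exist _ (@unit_map (sval S)) (eta_mor S))
    (fun X => exist _ (counit_map (sval X)) (eps_mor X)).
Proof.
have O_obj (S : OrdTopOC) : satisfies_P (Opens_locale (sval S)).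
  by have [oc ep] := svalP S; exact: Opens_satisfies_P.
have O_mor (S T : OrdTopOC) (g : hom S T) : monotone (Opens_map g).
  by have [oc _] := svalP T; exact: Opens_map_monotone.
have pt_obj (X : OrdLocP) :
    open_cones (pt_space (sval X)) /\ enough_points (pt_space (sval X)).
  by split; [exact: pt_open_cones (svalP X) | exact: pt_enough_points].
have pt_mor (X Y : OrdLocP) (f : hom X Y) :
    @is_ordtop_hom (pt_space (sval X)) (pt_space (sval Y)) (pt_map (sval f)).
  exact: pt_map_mor (svalP f).
exists O_obj, O_mor, pt_obj, pt_mor.
have O_functor : @is_functor OrdTopOC OrdLocP
    (fun S => exist _ (Opens_locale (sval S)) (O_obj S))
    (fun S T g => exist _ (Opens_map g) (O_mor S T g)).
  by split=> *; exact: opens_hom_eq.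
have pt_functor : @is_functor OrdLocP OrdTopOC
    (fun X => exist _ (pt_space (sval X)) (pt_obj X))
    (fun X Y f => exist _ (pt_map (sval f)) (pt_mor X Y f)).
  by split=> *; exact: pt_hom_eq.
exists O_functor, pt_functor.
have eta_mor (S : OrdTopOC) : is_ordtop_hom (@unit_map (sval S)).
  by have [oc _] := svalP S; exact: unit_map_mor.
exists eta_mor, (fun X => counit_map_monotone (sval X)).
split=> [S T g | X Y f | S | X].
- by apply: (@pt_hom_eq (sval S) (Opens_locale (sval T))).
- by apply: (@opens_hom_eq (pt_space (sval X)) (sval Y)).
- by apply: (@opens_hom_eq (sval S) (Opens_locale (sval S))).
- by apply: (@pt_hom_eq (pt_space (sval X)) (sval X)).
Qed.
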